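(* Almost every graph is reconstructible; that is, the probability that a random graph on $n$ labeled vertices, in which edges are chosen independently with probability $1/2$, is reconstructible tends to $1$ as $n\to\infty$.
   Context: All graphs are finite and simple. The deck of $G$ is the multiset of isomorphism types of the graphs obtained from $G$ by deleting one vertex, in every possible way. $G$ is reconstructible if every graph with the same deck as $G$ is isomorphic to $G$. *)

(* Defs.v *)
From HB Require Import structures.
From mathcomp Require Import all_boot all_order all_algebra.
From mathcomp Require Import all_classical all_reals all_analysis.

Set Implicit Arguments.
Unset Strict Implicit.
Unset Printing Implicit Defensive.

Import Order.TTheory GRing.Theory Num.Theory.
Local Open Scope ring_scope.

Record sgraph := SGraph {
  vertex :> finType;
  edge : rel vertex;
  edge_sym : symmetric edge;
  edge_irrefl : irreflexive edge }.

Definition isomorphic (G H : sgraph) : Prop :=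
  exists2 f : G -> H, bijective f & forall x y, edge (f x) (f y) = edge x y.

Section DeleteVertex.
Variables (G : sgraph) (v : G).

Let del_edge : rel {x : G | x != v} := fun x y => edge (val x) (val y).

Let del_edge_sym : symmetric del_edge.
Proof. by move=> x y; apply: edge_sym. Qed.

Let del_edge_irrefl : irreflexive del_edge.
Proof. by move=> x; apply: edge_irrefl. Qed.

Definition del_vertex : sgraph := SGraph del_edge_sym del_edge_irrefl.

End DeleteVertex.

(* The deck, a multiset of isomorphism types, is given by its multiplicity
   function; an isomorphism type is passed through any representative K. *)
Definition deck (G : sgraph) : sgraph -> nat :=
  fun K => #|[pred v : G | `[< isomorphic (del_vertex v) K >]]|.

Definition reconstructible (G : sgraph) : Prop :=
  forall H : sgraph, deck H =1 deck G -> isomorphic H G.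

Definition vertex_pairs (n : nat) : {set {set 'I_n}} :=
  [set e : {set 'I_n} | #|e| == 2]%SET.

Section LabeledGraph.
Variables (n : nat) (E : {set {set 'I_n}}).

Let lab_edge : rel 'I_n := fun i j => (i != j) && ([set i; j]%SET \in E).

Let lab_edge_sym : symmetric lab_edge.
Proof. by move=> i j; rewrite /lab_edge eq_sym finset.setUC. Qed.

Let lab_edge_irrefl : irreflexive lab_edge.
Proof. by move=> i; rewrite /lab_edge eqxx. Qed.

Definition labeled_graph : sgraph := SGraph lab_edge_sym lab_edge_irrefl.

End LabeledGraph.

(* Since the edges are independent, the random graph has edge set exactly E
   with probability the product, over all pairs of vertices e, of p if e is
   in E and of 1 - p otherwise. *)
Definition edge_set_prob (R : realType) (n : nat) (p : R)
    (E : {set {set 'I_n}}) : R :=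
  \prod_(e in vertex_pairs n) (if e \in E then p else 1 - p).

Definition random_graph_prob (R : realType) (n : nat) (p : R)
    (A : sgraph -> Prop) : R :=
  \sum_(E in finset.powerset (vertex_pairs n) | `[< A (labeled_graph E) >])
    edge_set_prob p E.

(* Main.v *)
Require Import Defs.
From mathcomp Require Import all_boot all_order all_algebra.
From mathcomp Require Import all_classical all_reals all_analysis.
From mathcomp Require Import finset zify ring lra.
Import Order.TTheory GRing.Theory Num.Theory.
Import numFieldNormedType.Exports.

Set Implicit Arguments.
Unset Strict Implicit.
Unset Printing Implicit Defensive.

(** Call a graph rigid when the inclusion is the only induced embedding into G
of any subgraph obtained by deleting two vertices. Two facts give the theorem.

A rigid graph G with at least three vertices is reconstructible
([rigid_reconstructible]). If H has the deck of G, then for each vertex x of H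
the card H - x embeds into G by some map F x. For x <> y, the map that sends
F x z to F y z is an embedding into G of a subgraph that misses two vertices, so
it is the inclusion: F x and F y agree wherever both are constrained. Hence all
the F x are restrictions of one map from H to G. Injectivity and preservation
of adjacency concern two vertices at a time, and for any two vertices there is a
third vertex x whose F x sees both, so the common map is an isomorphism.

A random graph is rigid with probability tending to 1. A failure of rigidity is
witnessed by a pair S and a map f that is the identity on S, injective off S and
different from the identity. When f moves m vertices, one can find a set D of at
least k m pairs, with k of order n, such that no pair of D has its image in D
([exists_independent_pairs]). If f preserves adjacency off S, then the edges
inside D are determined by those outside D, which has probability at most
q ^ m, where q = 2 ^ -k ([card_preserved]). Instead of classifying the maps f by
m, the union bound uses the exact generating function: the sum of q ^ m over all
self-maps of an n-set is the expanded product (1 + (n - 1) q) ^ n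
([sum_exp_moved]). Removing the identity leaves about n^2 q, and the choice of S
costs a further factor n^2. As n^4 / 2 ^ k tends to 0, so does the probability
of failure. *)

(** * Rigid graphs are reconstructible *)

(** An embedding of G - S is encoded as a total function on G that is
constrained off S only, so that the identity can be stated without subtypes. *)
Definition rigid (G : sgraph) : Prop :=
  forall (S : {set G}) (f : G -> G), #|S| = 2 -> {in ~: S &, injective f} ->
    {in ~: S &, forall x y, edge (f x) (f y) = edge x y} ->
  {in ~: S, f =1 id}.

Lemma isomorphic_card (G H : sgraph) : isomorphic G H -> #|G| = #|H|.
Proof. by case=> f fbij _; apply: bij_eq_card fbij. Qed.

Lemma card_del_vertex (G : sgraph) (v : G) : #|del_vertex v| = #|G|.-1.
Proof. by rewrite card_sig cardC1. Qed.

Lemma isomorphic_refl (G : sgraph) : isomorphic G G.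
Proof. by exists id => //; exists id. Qed.

Lemma deck_del_vertex_gt0 (G : sgraph) (v : G) : (0 < deck G (del_vertex v))%N.
Proof.
by apply/card_gt0P; exists v; rewrite inE; apply/asboolP/isomorphic_refl.
Qed.

Lemma deck_card (G H : sgraph) : (2 < #|G|)%N -> deck H =1 deck G -> #|H| = #|G|.
Proof.
move=> G_gt2 eq_deck.
have /card_gt0P[v _] : (0 < #|G|)%N by lia.
have := deck_del_vertex_gt0 v; rewrite -eq_deck => /card_gt0P[x].
rewrite inE => /asboolP/isomorphic_card; rewrite !card_del_vertex.
have /card_gt0P : exists y : H, y \in H by exists x.
lia.
Qed.

(** Up to isomorphism H - x is a card of G, hence an induced subgraph of G. *)
Lemma deck_card_embedding (G H : sgraph) (x : H) :
  deck H =1 deck G ->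
  exists2 f : H -> G, {in predC1 x &, injective f} &
    {in predC1 x &, forall y z, edge (f y) (f z) = edge y z}.
Proof.
move=> eq_deck.
have := deck_del_vertex_gt0 x; rewrite eq_deck => /card_gt0P[v].
rewrite inE => /asboolP[g [h gK hK] g_edge].
have h_edge y z : edge (h y) (h z) = edge y z by rewrite -g_edge !hK.
pose f y : G := if insub y is Some u then val (h u) else v.
have fE y (yx : y != x) : f y = val (h (Sub y yx)) by rewrite /f insubT.
exists f => y z; rewrite !inE => yx zx; rewrite !fE.
  by move/val_inj/(can_inj hK)/(congr1 val).
by have := h_edge (Sub y yx) (Sub z zx).
Qed.

Lemma exists_third (T : finType) (y z : T) :
  (2 < #|T|)%N -> exists2 x, x != y & x != z.
Proof.
move=> T_gt2; have : (0 < #|~: [set y; z]|)%N.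
  by rewrite cardsCs setCK cards2; lia.
by case/card_gt0P=> x; rewrite !inE negb_or => /andP[]; exists x.
Qed.

(** The map f z |-> g z, defined on the image under f of the vertices other than
x and y, is an embedding that misses two vertices of G. *)
Lemma rigid_embeddings_agree (G H : sgraph) (x y : H) (f g : H -> G) :
  rigid G -> #|H| = #|G| -> x != y ->
  {in predC1 x &, injective f} ->
  {in predC1 x &, forall u v, edge (f u) (f v) = edge u v} ->
  {in predC1 y &, injective g} ->
  {in predC1 y &, forall u v, edge (g u) (g v) = edge u v} ->
  {in ~: [set x; y], f =1 g}.
Proof.
move=> rigG eqHG xy f_inj f_edge g_inj g_edge.
set U := ~: [set x; y].
have Ux u : u \in U -> u \in predC1 x by rewrite !inE negb_or => /andP[].
have Uy u : u \in U -> u \in predC1 y by rewrite !inE negb_or => /andP[].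
have fU_inj : {in U &, injective f} by move=> u v /Ux ? /Ux ?; apply: f_inj.
pose S := ~: (f @: U).
pose h w := if [pick u in U | f u == w] is Some u then g u else w.
have hf u : u \in U -> h (f u) = g u.
  move=> uU; rewrite /h; case: pickP => [v /andP[vU /eqP/fU_inj ->] //|].
  by move/(_ u); rewrite uU eqxx.
have hS w : w \in ~: S -> exists2 u, u \in U & w = f u.
  by rewrite setCK => /imsetP.
move=> u uU; rewrite -(hf u uU); apply/esym/(rigG S).
- rewrite /S cardsCs setCK card_in_imset // cardsCs setCK cards2 xy -eqHG subKn //.
  by apply: leq_trans (max_card (mem [set x; y])); rewrite cards2 xy.
- move=> _ _ /hS[a aU ->] /hS[b bU ->]; rewrite !hf // => /g_inj-> //; exact: Uy.
- by move=> _ _ /hS[a aU ->] /hS[b bU ->]; rewrite !hf // g_edge ?f_edge //; auto.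
- by rewrite setCK imset_f.
Qed.

Lemma rigid_reconstructible (G : sgraph) :
  (2 < #|G|)%N -> rigid G -> reconstructible G.
Proof.
move=> G_gt2 rigG H eq_deck.
have eqHG := deck_card G_gt2 eq_deck.
have [F FP] : exists F : H -> H -> G, forall x,
    {in predC1 x &, injective (F x)} /\
    {in predC1 x &, forall y z, edge (F x y) (F x z) = edge y z}.
  apply: (@fin_all_exists H (fun=> H -> G) (fun x f => {in predC1 x &, injective f} /\
    {in predC1 x &, forall y z, edge (f y) (f z) = edge y z})) => x.
  by have [f] := deck_card_embedding x eq_deck; exists f.
have avoid (y z : H) : exists2 x, y \in predC1 x & z \in predC1 x.
  have [|x xy xz] := @exists_third H y z; first by rewrite eqHG.
  by exists x; rewrite inE eq_sym.
(* All the F x glue to one map tau; the value at y can be read off any F x with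
   x different from y. *)
have [tau tauE] : exists tau : H -> G, forall y x, y \in predC1 x -> tau y = F x y.
  apply: (@fin_all_exists H (fun=> G) (fun y w => forall x, y \in predC1 x -> w = F x y)) => y.
  have [x yx _] := avoid y y; exists (F x y) => x' yx'.
  have [-> //|xx'] := eqVneq x x'.
  have [Fi Fe] := FP x; have [Fi' Fe'] := FP x'.
  apply: rigid_embeddings_agree xx' Fi Fe Fi' Fe' _ _ => //.
  by move: yx yx'; rewrite !inE negb_or => -> ->.
exists tau.
  apply: inj_card_bij; last by rewrite eqHG.
  by move=> y z; have [x yx zx] := avoid y z; rewrite !(tauE _ x) //; apply: (FP x).1.
by move=> y z; have [x yx zx] := avoid y z; rewrite !(tauE _ x) //; apply: (FP x).2.
Qed.

(** * Edge sets preserved by a partial embedding *)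

(** Membership of e in E is dictated by membership of phi e, and phi e lies
outside D, so E is determined by its part outside D. *)
Lemma card_determined_subsets (X : finType) (P D : {set X}) (phi : X -> X) :
  D \subset P -> {in D, forall e, phi e \notin D} ->
  #|[set E in powerset P | [forall e in D, (e \in E) == (phi e \in E)]]| * 2 ^ #|D|
    <= 2 ^ #|P|.
Proof.
move=> DP phiD; rewrite -(cardsID D P) (setIidPr DP) addnC expnD leq_mul2r.
apply/orP; right; rewrite -card_powerset.
rewrite -(card_in_imset (f := fun E => E :\: D)).
  apply/subset_leq_card/fintype.subsetP => _ /imsetP[E + ->].
  by rewrite !inE => /andP[EP _]; apply: setSD.
move=> E E'; rewrite !inE => /andP[_ /forall_inP ED] /andP[_ /forall_inP ED'] eqE.
have off e : e \notin D -> (e \in E) = (e \in E').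
  by move=> eD; move/setP/(_ e): eqE; rewrite !inE eD.
apply/setP => e; have [eD|/off //] := boolP (e \in D).
by rewrite (eqP (ED e eD)) (eqP (ED' e eD)) off ?phiD.
Qed.

Lemma card_pairs_between (T : finType) (A B : {set T}) : [disjoint A & B] ->
  #|[set [set a; b] | a in A, b in B]| = (#|A| * #|B|)%N.
Proof.
move=> AB; rewrite curry_imset2X card_in_imset ?cardsX //.
move=> [a b] [a' b'] /setXP[/= aA bB] /setXP[/= a'A b'B] eqab.
have ab (x y : T) : x \in A -> y \in B -> x != y.
  by move=> xA yB; apply: contraTneq yB => <-; rewrite (disjointFr AB).
have : a \in [set a'; b'] by rewrite -eqab set21.
have : b \in [set a'; b'] by rewrite -eqab set22.
rewrite !inE (negPf (ab a b' _ _)) // orbF eq_sym (negPf (ab a' b _ _)) //=.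
by move=> /eqP-> /eqP->.
Qed.

Section Moved.
Variables (T : finType) (S : {set T}) (f : T -> T).
Hypotheses (f_inj : {in ~: S &, injective f}) (fS : {in S, f =1 id}).

Definition moved := [set x | f x != x].

Lemma movedS : moved \subset ~: S.
Proof.
by apply/fintype.subsetP => x; rewrite !inE; apply: contra => /fS ->.
Qed.

Lemma card_preimS (A : {set T}) : #|[set x in ~: S | f x \in A]| <= #|A|.
Proof.
rewrite -(card_in_imset (f := f)); last first.
  by move=> x y /setIdP[xS _] /setIdP[yS _]; apply: f_inj.
by apply/subset_leq_card/fintype.subsetP => _ /imsetP[x /setIdP[_ ?] ->].
Qed.

(** Let A be maximal among the sets of moved points that are disjoint from
their image and have at most a quarter of the points. If the size constraint
does not stop A from growing, each moved point is in A, in its image or in its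
preimage, whence at most 3 |A| moved points; otherwise 4 |A| + 4 exceeds the
number n >= 4 of points, so that A is nonempty and n <= 4 |A| + 3 <= 7 |A|. The
upper bound on the size of A leaves room for many pairs with just one end in
A. *)
Lemma exists_separated_set : 4 <= #|T| ->
  exists A : {set T}, [/\ A \subset moved, {in A, forall x, f x \notin A},
    4 * #|A| <= #|T| & #|moved| <= 7 * #|A|].
Proof.
move=> T_ge4.
pose ok (A : {set T}) := [&& A \subset moved, [forall x in A, f x \notin A]
  & 4 * #|A| <= #|T|].
have ok0 : ok set0.
  by rewrite /ok sub0set cards0 muln0 leq0n andbT; apply/forall_inP=> x; rewrite inE.
have [A /maxsetP[/and3P[Am /forall_inP Af A4] Amax] _] := maxset_exists ok0.
exists A; split=> //.
have [A4'|A4'] := ltnP #|T| (4 * #|A|.+1).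
  by have := max_card (mem moved); rewrite -[#|mem moved|]/#|moved|; lia.
suff sub : moved \subset A :|: (f @: A :|: [set x in ~: S | f x \in A]).
  have := subset_leq_card sub.
  have := card_preimS A; have := leq_imset_card f A.
  have := leq_card_setU A (f @: A :|: [set x in ~: S | f x \in A]).
  have := leq_card_setU (f @: A) [set x in ~: S | f x \in A].
  case=> + _ [+ _]; lia.
apply/fintype.subsetP => x xm; apply: contraT; rewrite !inE !negb_or.
move=> /and3P[xA xfA]; rewrite negb_and negbK => xf.
have {}xf : f x \notin A.
  by case/orP: xf => // xS; move: xm; rewrite inE fS // eqxx.
suff /Amax/(_ (subsetUr _ _)) eqA : ok (x |: A).
  by rewrite -eqA setU11 in xA.
rewrite /ok cardsU1 xA A4' andbT subUset sub1set xm Am /=.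
apply/forall_inP => y; rewrite !inE => /orP[/eqP->|yA].
  by rewrite negb_or xf andbT; move: xm; rewrite inE.
rewrite negb_or Af // andbT; apply: contraNneq xfA => <-.
exact: imset_f.
Qed.

(** This is preservation of adjacency off S for the graph with edge set E. *)
Definition preserved (E : {set {set T}}) :=
  {in ~: S &, forall x y, x != y -> ([set f x; f y] \in E) = ([set x; y] \in E)}.

(** D consists of the pairs with one end in a separated set A and the other end
in a set B that avoids S, A and the preimage of A. Neither end of such a pair is
mapped into A, while every pair of D meets A, so no image of a pair of D is in
D. The cardinality of D is |A| |B|, where |B| >= n - 2 - 2 |A| >= n / 2 - 2 >= 7 k
and 7 |A| >= m. *)
Lemma exists_independent_pairs k : 14 * k + 4 <= #|T| -> #|S| = 2 ->
  exists D : {set {set T}}, [/\ D \subset [set e : {set T} | #|e| == 2],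
   {in D, forall e : {set T}, f @: e \notin D},
   k * #|moved| <= #|D| &
   forall e, e \in D -> exists x y, [/\ x \notin S, y \notin S, x != y & e = [set x; y]]].
Proof.
move=> kT S2.
have [|A [Am Af A4 mA]] := exists_separated_set; first lia.
pose B := ~: (A :|: (S :|: [set x in ~: S | f x \in A])).
have AB : [disjoint A & B].
  rewrite disjoints_subset; apply/fintype.subsetP => x xA.
  by rewrite !inE xA.
have eD e : e \in [set [set a; b] | a in A, b in B] ->
  exists x y, [/\ x \in A, y \in B, [/\ x \notin S, y \notin S & x != y] & e = [set x; y]].
  case/imset2P=> a b aA bB ->; exists a, b; split=> //; split.
  - by have /fintype.subsetP/(_ a) := fintype.subset_trans Am movedS; rewrite inE; apply.
  - by move: bB; rewrite !inE !negb_or => /and3P[].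
  - by apply: contraTneq bB => <-; rewrite (disjointFr AB).
exists [set [set a; b] | a in A, b in B]; split.
- apply/fintype.subsetP => e /eD[x [y [_ _ [_ _ xy] ->]]].
  by rewrite inE cards2 xy.
- move=> e /eD[x [y [xA yB [xS yS xy] ->]]]; apply/negP => /eD[a [b [aA _ _ eqab]]].
  have : a \in f @: [set x; y] by rewrite eqab set21.
  rewrite imsetU1 imset_set1 !inE => /orP[/eqP ax|/eqP ay].
    by have := Af x xA; rewrite -ax aA.
  by move: yB; rewrite !inE -ay aA yS !orbT.
- rewrite card_pairs_between //.
  have cB : #|T| <= #|B| + (#|A| + (2 + #|A|)).
    rewrite -(cardsC B) leq_add2l /B setCK -S2.
    apply: leq_trans (leq_card_setU _ _).1 _; rewrite leq_add2l.
    apply: leq_trans (leq_card_setU _ _).1 _; rewrite leq_add2l.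
    exact: card_preimS.
  have kB : 7 * k <= #|B| by lia.
  have := leq_mul (leqnn #|A|) kB; have := leq_mul (leqnn k) mA; lia.
- by move=> e /eD[x [y [_ _ [xS yS xy] ->]]]; exists x, y.
Qed.

Lemma card_preserved k : 14 * k + 4 <= #|T| -> #|S| = 2 ->
  #|[set E in powerset [set e : {set T} | #|e| == 2] | `[< preserved E >]]|
    * 2 ^ (k * #|moved|) <= 2 ^ #|[set e : {set T} | #|e| == 2]|.
Proof.
move=> kT S2; have [D [DP Df kD De]] := exists_independent_pairs kT S2.
apply: leq_trans (card_determined_subsets DP Df).
apply: leq_mul; last by rewrite leq_exp2l.
apply/subset_leq_card/fintype.subsetP => E; rewrite !inE => /andP[-> /asboolP fE] /=.
apply/forall_inP => e /De[x [y [xS yS xy ->]]].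
by rewrite imsetU1 imset_set1 fE ?inE.
Qed.
End Moved.

(** * The union bound *)

Lemma card_bigcup_le (I T : finType) (P : pred I) (F : I -> {set T}) :
  (#|\bigcup_(i | P i) F i| <= \sum_(i | P i) #|F i|)%N.
Proof.
elim/big_rec2: _ => [|i m A _ leAm]; first by rewrite cards0.
by apply: leq_trans (leq_card_setU _ _).1 _; rewrite leq_add2l.
Qed.

Local Open Scope ring_scope.

(** Choosing f amounts to choosing each value f x independently, and x
contributes a factor 1 if it is fixed and q for each of the other values: this is
distributivity of the product over x. *)
Lemma sum_exp_moved (R : comPzRingType) (T : finType) (q : R) :
  \sum_(f : {ffun T -> T}) q ^+ #|moved f| = (1 + q *+ #|T|.-1) ^+ #|T|.
Proof.
pose F (x y : T) : R := if y != x then q else 1.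
have sumF x : \sum_y F x y = 1 + q *+ #|T|.-1.
  rewrite (bigD1 x) //= {1}/F eqxx; congr (_ + _).
  under eq_bigr => y yx do rewrite /F yx.
  by rewrite sumr_const cardC1.
have -> : (1 + q *+ #|T|.-1) ^+ #|T| = \prod_(x : T) \sum_y F x y.
  by rewrite -(eq_bigr _ (fun x _ => esym (sumF x))) prodr_const.
rewrite bigA_distr_bigA; apply: eq_bigr => f _.
by rewrite -big_mkcond /= -prodr_const; apply: eq_bigl => x; rewrite inE.
Qed.

(** Along the induction on n, the bound 2 n x <= 1 absorbs the quadratic term
2 n x ^ 2 of the product (1 + 2 n x) (1 + x). *)
Lemma exp1D_le (R : realFieldType) (x : R) n :
  0 <= x -> 2 * n%:R * x <= 1 -> (1 + x) ^+ n <= 1 + 2 * n%:R * x.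
Proof.
move=> x0; elim: n => [|n IHn] nx; first by rewrite expr0 mulr0 mul0r addr0.
rewrite exprSr; rewrite -natr1 in nx *.
have nx' : 2 * n%:R * x <= 1 by nra.
apply: le_trans (ler_wpM2r _ (IHn nx')) _; first by rewrite addr_ge0.
nra.
Qed.

Section RandomGraph.
Variables (R : realType) (n : nat).

Lemma random_graph_prob_half (A : sgraph -> Prop) :
  random_graph_prob n (2^-1 : R) A =
    #|[set E in powerset (vertex_pairs n) | `[< A (labeled_graph E) >]]|%:R
      / 2 ^+ #|vertex_pairs n|.
Proof.
rewrite /random_graph_prob (eq_bigr (fun=> 2^-1 ^+ #|vertex_pairs n|)); last first.
  move=> E _; rewrite /edge_set_prob -prodr_const; apply: eq_bigr => e _.
  by case: ifP => // _; lra.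
rewrite -exprVn mulr_natl -sumr_const; apply: eq_bigl => E.
by rewrite [in RHS]inE.
Qed.

Lemma edge_labeled_graph (E : {set {set 'I_n}}) (x y : labeled_graph E) :
  edge x y = (x != y) && ([set x; y] \in E).
Proof. by []. Qed.

(** The witnesses of non-rigidity over which the union bound ranges. Requiring
the map to be the identity on S makes the number of points that it moves count
only points off S. *)
Definition distortion (p : {set 'I_n} * {ffun 'I_n -> 'I_n}) : bool :=
  [&& #|p.1| == 2, p.2 != [ffun x => x], [forall x in p.1, p.2 x == x] &
      `[< {in ~: p.1 &, injective p.2} >]].

Lemma not_rigid_distortion (E : {set {set 'I_n}}) :
  ~ rigid (labeled_graph E) -> exists2 p, distortion p & preserved p.1 p.2 E.
Proof.
move=> nrig; apply: contrapT => nex; apply: nrig => S f S2 f_inj f_edge.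
pose g := [ffun x => if x \in S then x else f x].
have gE x : x \notin S -> g x = f x by rewrite ffunE => /negPf ->.
have g_inj : {in ~: S &, injective g}.
  by move=> x y xS yS; rewrite !gE -?in_setC //; apply: f_inj.
suff gid : g = [ffun x => x].
  by move=> x; rewrite inE => /gE <-; rewrite gid ffunE.
apply: contrapT => /eqP g_id; apply: nex; exists (S, g).
  rewrite /distortion S2 g_id /=; apply/andP; split; last exact/asboolP.
  by apply/forall_inP => x xS; rewrite ffunE xS.
move=> x y xS yS xy /=; have := f_edge x y xS yS.
rewrite !edge_labeled_graph xy -!gE -?in_setC //.
by rewrite (inj_in_eq g_inj) // xy.
Qed.

Lemma card_not_rigid_le k : (14 * k + 4 <= n)%N ->
  #|[set E in powerset (vertex_pairs n) | ~~ `[< rigid (labeled_graph E) >]]|%:R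
    / 2 ^+ #|vertex_pairs n| <=
  n%:R ^+ 2 * ((1 + n%:R * 2^-1 ^+ k) ^+ n - 1) :> R.
Proof.
move=> kn; set N := #|vertex_pairs n|; set bad := [set E in _ | _].
pose ev (p : {set 'I_n} * {ffun 'I_n -> 'I_n}) :=
  [set E in powerset (vertex_pairs n) | `[< preserved p.1 p.2 E >]].
pose q : R := 2^-1 ^+ k.
have q0 : 0 <= q by rewrite exprn_ge0.
have evP p : distortion p -> #|ev p|%:R / 2 ^+ N <= q ^+ #|moved p.2|.
  case/and4P=> /eqP S2 _ /forall_inP fS /asboolP f_inj.
  have := @card_preserved _ _ _ f_inj (fun x xS => eqP (fS x xS)) k.
  rewrite card_ord => /(_ kn S2) evle.
  rewrite ler_pdivrMr ?exprn_gt0 // -exprM exprVn mulrC ler_pdivlMr ?exprn_gt0 //.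
  by rewrite -!natrX -natrM ler_nat.
have bad_sub : bad \subset \bigcup_(p | distortion p) ev p.
  apply/fintype.subsetP => E; rewrite inE => /andP[EP /asboolPn].
  case/not_rigid_distortion=> p pd pE; apply/bigcupP; exists p => //.
  by rewrite inE EP; apply/asboolP.
apply: (@le_trans _ _ (\sum_(p | distortion p) q ^+ #|moved p.2|)).
  rewrite ler_pdivrMr ?exprn_gt0 // mulr_suml.
  apply: (@le_trans _ _ (\sum_(p | distortion p) #|ev p|%:R)).
    rewrite -natr_sum ler_nat.
    exact: leq_trans (subset_leq_card bad_sub) (card_bigcup_le _ _).
  by apply: ler_sum => p /evP; rewrite ler_pdivrMr ?exprn_gt0.
pose id_f : {ffun 'I_n -> 'I_n} := [ffun x => x].
(* Enlarge the range to all pairs S and all maps f other than the identity, so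
   that the sum factors. *)
apply: (@le_trans _ _ (\sum_(S : {set 'I_n} | #|S| == 2)
    \sum_(f : {ffun 'I_n -> 'I_n} | f != id_f) q ^+ #|moved f|)).
  rewrite pair_big /= [leRHS](bigID distortion) /=.
  rewrite (eq_bigl (fun p : {set 'I_n} * {ffun 'I_n -> 'I_n} =>
      ((#|p.1| == 2) && (p.2 != id_f)) && distortion p)).
    by rewrite lerDl sumr_ge0 // => *; rewrite exprn_ge0.
  move=> p; rewrite [RHS]andb_idl // => /and4P[-> ? _ _]; exact.
have sumE : \sum_(f : {ffun 'I_n -> 'I_n} | f != id_f) q ^+ #|moved f| =
    (1 + q *+ n.-1) ^+ n - 1.
  have := sum_exp_moved 'I_n q; rewrite (bigD1 id_f) //= card_ord => <-.
  have -> : moved id_f = set0 by apply/setP => x; rewrite !inE ffunE eqxx.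
  by rewrite cards0 expr0 addrAC subrr add0r.
rewrite sumE sumr_const -[leLHS]mulr_natl.
have le1 : 1 + q *+ n.-1 <= 1 + n%:R * q.
  by rewrite lerD2l -[q *+ _]mulr_natl ler_wpM2r ?ler_nat ?leq_pred.
have ge1 : 1 <= 1 + q *+ n.-1 by rewrite lerDl mulrn_wge0.
apply: ler_pM => //.
- by rewrite subr_ge0 exprn_ege1.
- rewrite -natrX ler_nat -[X in (X <= _)%N](_ : #|[set S : {set 'I_n} | #|S| == 2]| = _).
    rewrite card_draws card_ord bin2 -divn2.
    by apply: leq_trans (leq_div _ _) _; rewrite leq_mul ?leq_pred.
  by rewrite cardsE.
- have ge0 := le_trans ler01 ge1.
  by rewrite lerD2r lerXn2r // nnegrE (le_trans ge0 le1).
Qed.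

Lemma random_graph_prob_reconstructible_ge k : (14 * k + 4 <= n)%N ->
  1 - 2 * n%:R ^+ 4 / 2 ^+ k <= random_graph_prob n (2^-1 : R) reconstructible.
Proof.
move=> kn; set P := random_graph_prob _ _ _.
have P0 : 0 <= P by rewrite /P random_graph_prob_half divr_ge0 ?exprn_ge0.
have n1 : 1 <= n%:R :> R by rewrite ler1n; lia.
pose x : R := n%:R * 2^-1 ^+ k.
have xE : 2 * n%:R ^+ 4 / 2 ^+ k = n%:R ^+ 2 * (2 * n%:R * x).
  by rewrite /x -exprVn; ring.
have x0 : 0 <= x by rewrite mulr_ge0 ?exprn_ge0.
(* If 2 n x > 1, the claimed lower bound is at most 0. *)
have [nx|nx] := lerP (2 * n%:R * x) 1; last first.
  apply: le_trans P0; rewrite subr_le0 xE.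
  by apply: le_trans (ler_peMl _ _); [exact: ltW| |]; rewrite ?exprn_ege1 //; lra.
have := card_not_rigid_le kn; set bad := [set E in _ | _] => bad_le.
pose good := [set E in powerset (vertex_pairs n) | `[< reconstructible (labeled_graph E) >]].
have : (2 ^ #|vertex_pairs n| <= #|good| + #|bad|)%N.
  rewrite -card_powerset; apply: leq_trans (leq_card_setU _ _).1.
  apply/subset_leq_card/fintype.subsetP => E EP; rewrite in_setU; apply/orP.
  have [/asboolP rE|nrE] := boolP `[< rigid (labeled_graph E) >]; [left|right].
    apply/setIdP; split=> //; apply/asboolP/rigid_reconstructible => //=.
    by rewrite card_ord; lia.
  by apply/setIdP.
rewrite -(ler_nat R) natrD natrX.
rewrite -(ler_pM2r (_ : 0 < (2 ^+ #|vertex_pairs n|)^-1)) ?invr_gt0 ?exprn_gt0 //.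
rewrite mulrDl divff ?expf_neq0 // -random_graph_prob_half -/P => leP.
rewrite xE lerBlDr; apply: le_trans leP _; rewrite lerD2l.
apply: le_trans bad_le _; rewrite ler_wpM2l ?exprn_ge0 // lerBlDl.
exact: exp1D_le.
Qed.

Lemma random_graph_prob_le1 (A : sgraph -> Prop) :
  random_graph_prob n (2^-1 : R) A <= 1.
Proof.
rewrite random_graph_prob_half ler_pdivrMr ?exprn_gt0 // mul1r -natrX ler_nat.
by rewrite -card_powerset; apply/subset_leq_card/fintype.subsetP => E /setIdP[].
Qed.

(** With k = 5 j and j about n / 70, 2 ^ k >= (j + 1) ^ 5 is at least
((n + 1) / 75) ^ 5, which beats n ^ 4 by a factor of order n. *)
Lemma random_graph_prob_reconstructible_rate : (4 <= n)%N ->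
  1 - 2 * 75 ^+ 5 * harmonic n <= random_graph_prob n (2^-1 : R) reconstructible.
Proof.
move=> n4; pose j := ((n - 4) %/ 70)%N.
have jn : (70 * j <= n - 4)%N by rewrite mulnC leq_divM.
have nj : (n - 4 < 70 * j.+1)%N by rewrite mulnC ltn_ceil.
have kn : (14 * (5 * j) + 4 <= n)%N by lia.
apply: le_trans (random_graph_prob_reconstructible_ge kn).
have : (n.+1 <= 75 * j.+1)%N by lia.
(* The rest holds for any c with n + 1 <= c (j + 1) in place of 75. *)
move: 75%N => c nc.
rewrite lerD2l lerN2 -[leLHS]mulrA -[leRHS]mulrA ler_pM2l // ler_pdivrMr ?exprn_gt0 //.
rewrite mulrAC /harmonic ler_pdivlMr // -!natrX -!natrM ler_nat.
apply: (@leq_trans (n.+1 ^ 5)); first by rewrite (expnSr _ 4) leq_mul // leq_exp2r.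
apply: (@leq_trans ((c * j.+1) ^ 5)); first by rewrite leq_exp2r.
rewrite expnMn leq_mul // mulnC expnM leq_exp2r //; exact: ltn_expl.
Qed.
End RandomGraph.

Local Open Scope classical_set_scope.

Theorem corollary2 (R : realType) :
  random_graph_prob n (2^-1 : R) reconstructible @[n --> \oo] --> (1 : R).
Proof.
apply: (@squeeze_cvgr _ _ _ _ (fun n => 1 - 2 * 75 ^+ 5 * harmonic n) (fun=> 1)).
- exists 4%N => // n /= n4.
  by rewrite random_graph_prob_le1 random_graph_prob_reconstructible_rate.
- rewrite -[X in _ --> X]subr0 -(mulr0 (2 * 75 ^+ 5)).
  by apply: cvgB; [exact: cvg_cst | apply: cvgMr; exact: cvg_harmonic].
- exact: cvg_cst.
Qed.
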